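(* Let $(P,\preceq)$ be a power lattice with rank function $\rho$ and a fixed total order $\preceq_1$ on its atoms, and let $(P,\mathcal{I})$ be a matroid in $P$. Let $\mathcal{B}$ be the set of bases of the matroid, whose elements have rank $r$. Then $\mathcal{I}$ is a shellable $\mathcal{P}$-complex where the elements of $\mathcal{B}$ (its facets) are ordered with $\preceq_r$.
   Context: Power lattices. Let $(P,\preceq)$ be a finite lattice with minimum $\hat 0$, maximum $\hat 1$, and a rank function $\rho:P\to\mathbb{N}$ ($\rho(\hat 0)=0$; $x\prec y$ implies $\rho(x)<\rho(y)$; if $y$ covers $x$ then $\rho(y)=\rho(x)+1$). $P(l)$ is the set of elements of rank $l$; elements of $P(1)$ are atoms. $P$ is semimodular if $\rho(x\vee y)+\rho(x\wedge y)\le\rho(x)+\rho(y)$ for all $x,y$. Put $A(x)=\{w\in P(1): w\preceq x\}$. For an atom $w$, $\mathrm{pow}(w)=\{y\in P: A(y)=\{w\}\}$ is the set of powers of $w$. The $w$-multiplicity is $v_w(y)=\max\{\rho(z): z\preceq y,\ z\in\mathrm{pow}(w)\}$ if $w\preceq y$, and $v_w(y)=0$ otherwise. A power lattice is a finite semimodular ranked lattice such that (i) for every atom $w$ and integer $r$ there is at most one element of rank $r$ in $\mathrm{pow}(w)$; (ii) for all $x,y\in P$, $\sum_{w\in P(1)}v_w(x)=\sum_{w\in P(1)}v_w(y)$ if and only if $\rho(x)=\rho(y)$. For an atom $w$, $w^k$ denotes the element of $\mathrm{pow}(w)$ of rank $k$ when it exists. Orders. Fix a total order $\preceq_1$ on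 $P(1)$. The factorization $F(x)$ is the sequence listing the atoms $w\in A(x)$ in increasing $\preceq_1$-order, each repeated $v_w(x)$ times. For $x\ne y$ in $P(l)$ (their factorizations then have the same length and are distinct), $x\prec_l y$ iff at the first index $i$ where $F(x)=(x_1,\dots,x_t)$ and $F(y)=(y_1,\dots,y_t)$ differ one has $x_i\prec_1 y_i$. This is a total order $\preceq_l$ on $P(l)$. Matroids. A matroid $(P,\mathcal{I})$ on $P$ is given by a subset $\mathcal{I}\subseteq P$ such that (I1) $\hat 0\in\mathcal{I}$; (I2) if $x\preceq y$ and $y\in\mathcal{I}$ then $x\in\mathcal{I}$; (I3) for all $x,y\in\mathcal{I}$ with $\rho(x)<\rho(y)$ there is an atom $a\in P$ such that $v_a(x)<v_a(y)$ and $x\vee a^{v_a(x)+1}\in\mathcal{I}$. A basis is a maximal element of $\mathcal{I}$ with respect to $\preceq$. All bases have the same rank. Shellability. A $\mathcal{P}$-complex in $P$ is a non-empty subset $S$ of $P$ closed downward under $\preceq$; its facets are its maximal elements. A $\mathcal{P}$-complex whose facets all have rank $r$ is shellable with respect to an ordering $f_1,\dots,f_t$ of its facets if for all $1\le i<j\le t$ there is $k<j$ with $f_i\wedge f_j\preceq f_k\wedge f_j$ and $\rho(f_k\wedge f_j)=r-1$. *)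

(* Defs.v *)
From mathcomp Require Import all_boot all_order.

Set Implicit Arguments.
Unset Strict Implicit.
Unset Printing Implicit Defensive.

Import Order.TTheory.
Local Open Scope nat_scope.

Section PowerLattice.
Context {disp : Order.disp_t} {P : finTBLatticeType disp}.
Variable rho : P -> nat.
Implicit Types (w x y z : P) (S : {set P}).

Definition covers x y : bool := (x < y)%O && ~~ [exists z, (x < z < y)%O].

Definition rank_function : Prop :=
  [/\ rho \bot%O = 0,
      forall x y, (x < y)%O -> rho x < rho y
    & forall x y, covers x y -> rho y = (rho x).+1].

Definition semimodular : Prop :=
  forall x y, rho (x `|` y)%O + rho (x `&` y)%O <= rho x + rho y.

Definition atoms : {set P} := [set w | rho w == 1].

Definition atoms_below x : {set P} := [set w in atoms | (w <= x)%O].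

Definition powers w : {set P} := [set y | atoms_below y == [set w]].

(* The element [w^k] need not exist, so it is a relation rather than a
   function; in a power lattice at most one [y] satisfies it. *)
Definition is_power w k y : Prop := y \in powers w /\ rho y = k.

Definition vmult w y : nat :=
  if (w <= y)%O then \max_(z in powers w | (z <= y)%O) rho z else 0.

Definition power_lattice : Prop :=
  [/\ rank_function,
      semimodular,
      forall w k y z, w \in atoms -> is_power w k y -> is_power w k z -> y = z
    & forall x y, \sum_(w in atoms) vmult w x = \sum_(w in atoms) vmult w y
                  <-> rho x = rho y].

(* Only the restriction of [le1] to the atoms is ever used. *)
Definition total_order_on_atoms (le1 : rel P) : Prop :=
  [/\ {in atoms, reflexive le1},
      {in atoms &, antisymmetric le1},
      {in atoms & &, transitive le1}
    & {in atoms &, total le1}].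

Definition factorization (le1 : rel P) x : seq P :=
  flatten [seq nseq (vmult w x) w | w <- sort le1 (enum (atoms_below x))].

(* Strict comparison by [le1] at the first index where [s] and [t] differ;
   [false] if they do not differ before one of them ends. *)
Fixpoint first_diff_lt (le1 : rel P) (s t : seq P) : bool :=
  match s, t with
  | a :: s', b :: t' => if a == b then first_diff_lt le1 s' t' else le1 a b
  | _, _ => false
  end.

Definition rank_lt (le1 : rel P) (l : nat) : rel P := fun x y =>
  [&& rho x == l, rho y == l, x != y
    & first_diff_lt le1 (factorization le1 x) (factorization le1 y)].

Definition rank_le (le1 : rel P) (l : nat) : rel P := fun x y =>
  ((rho x == l) && (x == y)) || rank_lt le1 l x y.

Definition maximal_elements S : {set P} :=
  [set x in S | ~~ [exists y in S, (x < y)%O]].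

Definition matroid (I : {set P}) : Prop :=
  [/\ \bot%O \in I,
      forall x y, (x <= y)%O -> y \in I -> x \in I
    & forall x y, x \in I -> y \in I -> rho x < rho y ->
        exists a p, [/\ a \in atoms, vmult a x < vmult a y,
                        is_power a (vmult a x).+1 p & (x `|` p)%O \in I]].

Definition bases (I : {set P}) : {set P} := maximal_elements I.

Definition P_complex S : Prop :=
  S != set0 /\ forall x y, (x <= y)%O -> y \in S -> x \in S.

Definition facets S : {set P} := maximal_elements S.

(* [fs] lists the facets, indexed from 0; rank [r - 1] is written without
   truncated subtraction. *)
Definition shellable_wrt S (r : nat) (fs : seq P) : Prop :=
  let f i := nth \bot%O fs i in
  [/\ P_complex S,
      forall x, x \in facets S -> rho x = r,
      uniq fs /\ fs =i facets S
    & forall i j, i < j < size fs ->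
        exists k, [/\ k < j, (f i `&` f j <= f k `&` f j)%O
                    & (rho (f k `&` f j)%O).+1 = r]].

End PowerLattice.

(* Main.v *)
(** Elements of equal rank are determined by their multiplicities, and comparing factorizations
    amounts to comparing multiplicities along the sorted list of atoms, the larger one coming
    first.  If the basis [x] precedes the basis [y], let [a] be the first atom with
    [v_a(y) < v_a(x)].  Then [(x /\ y) \/ a^(v_a(y) + 1)] lies below [x], hence is independent,
    and covers [x /\ y].  Augmenting it by powers taken from [y] produces a basis [z] that
    meets [y] in rank [r - 1].  Before [a] the multiplicities of [z] are at least those of
    [x /\ y], which are those of [y], and at [a] the one of [z] is larger: so [z] precedes [y]. *)
Require Import Defs.
From mathcomp Require Import all_boot all_order.

Set Implicit Arguments.
Unset Strict Implicit.
Unset Printing Implicit Defensive.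

Import Order.TTheory.
Local Open Scope nat_scope.

(** * Lexicographic comparison of multiplicity functions along a list *)

Section LexicographicMultiplicities.
Context {T : eqType}.
Implicit Types (f g h : T -> nat) (s : seq T).

(** The larger value makes [f] come first: an extra copy of a small atom postpones the later atoms,
    hence makes a factorization smaller. *)
Fixpoint lex_gt f g s : bool :=
  if s is w :: s' then if f w == g w then lex_gt f g s' else g w < f w
  else false.

Lemma lex_gt_irr f s : lex_gt f f s = false.
Proof. by elim: s => //= w s IHs; rewrite eqxx. Qed.

Lemma lex_gt_trans f g h s : lex_gt g f s -> lex_gt f h s -> lex_gt g h s.
Proof.
elim: s => //= w s IHs.
case: (ltngtP (f w) (g w)) => // [fg _|<- sgf]; last first.
  by case: eqVneq => // _ /(IHs sgf).
case: eqVneq => [<- _|_ hf]; first by rewrite gtn_eqF.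
by rewrite gtn_eqF ?(ltn_trans hf).
Qed.

Lemma lex_gt_total f g s : ~~ lex_gt f g s -> ~~ lex_gt g f s -> {in s, f =1 g}.
Proof.
elim: s => //= w s IHs.
case: ltngtP => // fg sfg sgf x; rewrite inE => /predU1P[->//|].
exact: IHs.
Qed.

Lemma lex_gtP f g s : lex_gt f g s ->
  exists s1 a s2, [/\ s = s1 ++ a :: s2, {in s1, f =1 g} & g a < f a].
Proof.
elim: s => //= w s IHs; case: eqVneq => [fg /IHs|_ fg]; last first.
  by exists [::], w, s.
move=> [s1 [a [s2 [-> eqfg lt_a]]]]; exists (w :: s1), a, s2; split=> // x.
by rewrite inE => /predU1P[->//|/eqfg].
Qed.

(** Weak inequalities before [a] suffice, since the first strict one among them already decides in
    favour of [f]. *)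
Lemma lex_gt_cat f g s1 a s2 :
  {in s1, forall w, g w <= f w} -> g a < f a -> lex_gt f g (s1 ++ a :: s2).
Proof.
move=> le_gf lt_a; elim: s1 le_gf => [|w s1 IHs] le_gf /=.
  by rewrite gtn_eqF.
case: eqVneq => [_|ne_fg]; last by rewrite ltn_neqAle eq_sym ne_fg le_gf ?mem_head.
by apply: IHs => x xs; apply: le_gf; rewrite inE xs orbT.
Qed.

Definition expand f s : seq T := flatten [seq nseq (f w) w | w <- s].

Lemma size_expand f s : size (expand f s) = \sum_(w <- s) f w.
Proof.
by elim: s => [|w s IHs]; rewrite ?big_nil // big_cons size_cat size_nseq -IHs.
Qed.

Lemma mem_expand f s : {subset expand f s <= s}.
Proof. by move=> x /flatten_mapP[w ws]; rewrite mem_nseq => /andP[_ /eqP->]. Qed.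

End LexicographicMultiplicities.

(** * From factorizations to multiplicities *)

Section FirstDifference.
Context {disp : Order.disp_t} {P : finTBLatticeType disp}.
Variable le1 : rel P.

Lemma first_diff_lt_nseq k w (s t : seq P) :
  first_diff_lt le1 (nseq k w ++ s) (nseq k w ++ t) = first_diff_lt le1 s t.
Proof. by elim: k => //= k; rewrite eqxx. Qed.

(** At the first [w] with [f w] and [g w] distinct, the common copies of [w] cancel; one side
    continues with [w], the other with a strictly later atom. Equal sums keep the latter from being
    exhausted, where [first_diff_lt] would return [false]. *)
Lemma first_diff_lt_expand (f g : P -> nat) s :
  pairwise [rel a b | le1 a b && ~~ le1 b a] s ->
  \sum_(w <- s) f w = \sum_(w <- s) g w ->
  first_diff_lt le1 (expand f s) (expand g s) = lex_gt f g s.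
Proof.
elim: s => //= w s IHs /andP[/allP w_lt s_lt].
have w_ne b : b \in s -> (b == w) = false.
  by move=> /w_lt /=; case: eqP => // ->; rewrite andbN.
rewrite !big_cons /expand /= -!/(expand _ _).
case: (ltngtP (f w) (g w)) => [lt_fg|lt_gf|->].
- rewrite -(subnKC lt_fg) addSnnS nseqD -catA first_diff_lt_nseq -addnA.
  move/addnI; rewrite -size_expand; have := @mem_expand _ f s.
  case: (expand f s) => //= b u /(_ b (mem_head _ _)) bs _.
  by rewrite w_ne //; have /andP[_ /negPf] := w_lt b bs.
- rewrite -(subnKC lt_gf) addSnnS nseqD -catA first_diff_lt_nseq -addnA.
  move/addnI/esym; rewrite -size_expand; have := @mem_expand _ g s.
  case: (expand g s) => //= b u /(_ b (mem_head _ _)) bs _.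
  by rewrite eq_sym w_ne //; have /andP[] := w_lt b bs.
- by move/addnI/(IHs s_lt); rewrite first_diff_lt_nseq.
Qed.

End FirstDifference.

(** * Ranks, powers and multiplicities in a power lattice *)

Section PowerLatticeTheory.
Context {disp : Order.disp_t} {P : finTBLatticeType disp}.
Variable rho : P -> nat.
Hypothesis powP : power_lattice rho.
Implicit Types (w x y z p : P) (I : {set P}).

Lemma rho_bot : rho \bot%O = 0.
Proof. by have [[]] := powP. Qed.

Lemma rho_lt x y : (x < y)%O -> rho x < rho y.
Proof. by have [[_ mono _] _ _ _] := powP; apply: mono. Qed.

Lemma rho_le x y : (x <= y)%O -> rho x <= rho y.
Proof. by rewrite le_eqVlt => /predU1P[->//|/rho_lt/ltnW]. Qed.

Lemma le_rho_eq x y : (x <= y)%O -> rho x = rho y -> x = y.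
Proof. by rewrite le_eqVlt => /predU1P[->//|/rho_lt] + eq_r; rewrite eq_r ltnn. Qed.

(** Climb from [x] one rank at a time: an element of least rank in the interval from [z] (excluded)
    to [y] covers [z]. *)
Lemma intermediate_rank x y k : (x <= y)%O -> rho x <= k <= rho y ->
  exists z, [/\ (x <= z)%O, (z <= y)%O & rho z = k].
Proof.
move=> le_xy /andP[/subnKC <-]; elim: (k - rho x) => [|n IHn].
  by exists x; rewrite addn0.
rewrite addnS => lt_ny; have [z [le_xz le_zy rz]] := IHn (ltnW lt_ny).
have lt_zy : (z < y)%O.
  by rewrite lt_neqAle le_zy andbT; apply: contraTneq lt_ny => <-; rewrite rz ltnn.
have Pz : (z < y <= y)%O by rewrite lt_zy lexx.
case: (@arg_minnP _ y (fun u => (z < u <= y)%O) rho Pz) => u /andP[lt_zu le_uy] min_u.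
exists u; split=> //; first exact: le_trans le_xz (ltW lt_zu).
rewrite -rz; have [[_ _ + _ _ _]] := powP; apply.
rewrite /covers lt_zu; apply/existsP => -[t /andP[lt_zt lt_tu]].
have := rho_lt lt_tu.
by rewrite ltnNge min_u // lt_zt (le_trans (ltW lt_tu)).
Qed.

Lemma atoms_belowP w x : reflect (rho w = 1 /\ (w <= x)%O) (w \in atoms_below rho x).
Proof. by rewrite !inE; apply: (iffP andP) => -[/eqP ? ?]; split. Qed.

Lemma power_ge w p : p \in powers rho w -> (w <= p)%O.
Proof.
rewrite inE => /eqP Ap; suff /atoms_belowP[] : w \in atoms_below rho p by [].
by rewrite Ap set11.
Qed.

(** Positive rank puts some atom below [z]; every such atom is below [p], hence is [w]. *)
Lemma power_down w p z : p \in powers rho w -> (z <= p)%O -> 0 < rho z ->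
  z \in powers rho w.
Proof.
rewrite inE => /eqP Ap le_zp rz_gt0.
have [|u [_ le_uz ru]] := @intermediate_rank \bot%O z 1 (le0x _).
  by rewrite rho_bot.
have sub t : t \in atoms_below rho z -> t = w.
  move=> /atoms_belowP[rt le_tz]; apply/set1P; rewrite -Ap.
  by apply/atoms_belowP; split=> //; apply: le_trans le_tz le_zp.
have Az_u : u \in atoms_below rho z by apply/atoms_belowP.
rewrite inE; apply/eqP/setP => t; rewrite in_set1.
by apply/idP/eqP => [/sub //|->]; rewrite -(sub u).
Qed.

Lemma atom_power w : w \in atoms rho -> w \in powers rho w.
Proof.
rewrite !inE => /eqP rw; apply/eqP/setP => t; rewrite in_set1.
apply/atoms_belowP/eqP => [[rt le_tw]|->]; last by rewrite lexx.
by apply: le_rho_eq => //; rewrite rt rw.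
Qed.

Lemma rho_le_vmult w p x : p \in powers rho w -> (p <= x)%O -> rho p <= vmult rho w x.
Proof.
move=> pw le_px; rewrite /vmult (le_trans (power_ge pw) le_px).
by apply: (leq_bigmax_cond (F := rho)); rewrite pw.
Qed.

Lemma power_le_exists w x k : w \in atoms rho -> 0 < k <= vmult rho w x ->
  exists p, is_power rho w k p /\ (p <= x)%O.
Proof.
move=> aw /andP[k_gt0]; rewrite /vmult; case: ifP => [le_wx|_]; last first.
  by rewrite leqNgt k_gt0.
have ne : 0 < #|[pred z in powers rho w | (z <= x)%O]|.
  by apply/card_gt0P; exists w; rewrite inE atom_power.
have [q /andP[qw le_qx] ->] := eq_bigmax_cond rho ne => le_kq.
have [|p [_ le_pq rp]] := @intermediate_rank \bot%O q k (le0x _).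
  by rewrite rho_bot.
exists p; split; last exact: le_trans le_pq le_qx.
by split=> //; apply: power_down qw le_pq _; rewrite rp.
Qed.

(** Some power of [w] of rank [k] lies below [x], and uniqueness of powers of a given rank
    identifies it with [p]. *)
Lemma power_le w k p x : w \in atoms rho -> is_power rho w k p ->
  k <= vmult rho w x -> (p <= x)%O.
Proof.
move=> aw wkp le_k; have [pw rp] := wkp.
have k_gt0 : 0 < k.
  by rewrite -rp; have := rho_le (power_ge pw); move: aw; rewrite inE => /eqP->.
have [|q [wkq le_qx]] := @power_le_exists w x k aw; first by rewrite k_gt0.
have [_ _ uniq_pow _] := powP.
by rewrite (uniq_pow w k p q).
Qed.

Lemma vmult_le w x y : w \in atoms rho -> (x <= y)%O -> vmult rho w x <= vmult rho w y.
Proof.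
move=> aw le_xy; have [->//|v_gt0] := posnP (vmult rho w x).
have [|p [[pw rp] le_px]] := @power_le_exists w x (vmult rho w x) aw.
  by rewrite v_gt0 /=.
by rewrite -rp; apply: rho_le_vmult pw (le_trans le_px le_xy).
Qed.

(** The power of [w] whose rank is the smaller multiplicity lies below both [x] and [y], hence below
    their meet. *)
Lemma vmultI w x y : w \in atoms rho ->
  vmult rho w (x `&` y)%O = minn (vmult rho w x) (vmult rho w y).
Proof.
move=> aw; apply/eqP; rewrite eqn_leq leq_min !vmult_le ?leIl ?leIr //=.
set k := minn _ _; have [->//|k_gt0] := posnP k.
have [|p [wkp le_px]] := @power_le_exists w x k aw.
  by rewrite k_gt0 geq_minl.
have le_py : (p <= y)%O by apply: power_le aw wkp (geq_minr _ _).
by have [pw <-] := wkp; apply: rho_le_vmult => //; rewrite lexI le_px.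
Qed.

(** The meet has the same multiplicities as [x] and [y], so equal sums give it their rank, and it
    coincides with both. *)
Lemma vmult_inj x y : {in atoms rho, forall w, vmult rho w x = vmult rho w y} -> x = y.
Proof.
move=> eq_v; have [_ _ _ sumP] := powP.
have Ix : (x `&` y)%O = x.
  apply: le_rho_eq (leIl _ _) _; apply/sumP; apply: eq_bigr => w aw.
  by rewrite vmultI // -eq_v // minnn.
have Iy : (x `&` y)%O = y.
  apply: le_rho_eq (leIr _ _) _; apply/sumP; apply: eq_bigr => w aw.
  by rewrite vmultI // eq_v // minnn.
by rewrite -Ix.
Qed.

(** * Joins with powers, augmentation and exchange *)

Lemma next_power_nle w u p : is_power rho w (vmult rho w u).+1 p -> ~~ (p <= u)%O.
Proof. by case=> pw rp; apply/negP => /(rho_le_vmult pw); rewrite rp ltnn. Qed.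

(** The meet of [u] and [p] has rank at least [vmult rho w u], one less than [p], so semimodularity
    bounds the increase by one; it is strict since [p] is not below [u]. *)
Lemma rho_join_next_power w u p : w \in atoms rho ->
  is_power rho w (vmult rho w u).+1 p -> rho (u `|` p)%O = (rho u).+1.
Proof.
move=> aw wp; have [pw rp] := wp; apply/eqP; rewrite eqn_leq; apply/andP; split.
  have [|q [_ le_qp rq]] := @intermediate_rank \bot%O p (vmult rho w u) (le0x _).
    by rewrite rho_bot rp /=.
  have le_qu : (q <= u)%O.
    (* Multiplicity zero is separate: [q] is then the bottom, which is not a power of [w]. *)
    have [v0|v_gt0] := posnP (vmult rho w u); last first.
      apply: (@power_le w (vmult rho w u)) => //; split=> //.
      by apply: power_down pw le_qp _; rewrite rq.
    by rewrite -(@le_rho_eq \bot%O q) ?le0x // rho_bot rq v0.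
  have [_ semi _ _] := powP; have := semi u p.
  have := @rho_le q (u `&` p)%O; rewrite lexI le_qu le_qp rq rp => /(_ isT) le_v.
  rewrite addnS -addSn => le_semi; rewrite -(leq_add2r (vmult rho w u)).
  by apply: leq_trans le_semi; rewrite leq_add2l.
apply: rho_lt; rewrite lt_neqAle leUl andbT eq_sym eq_joinl.
exact: next_power_nle wp.
Qed.

(** Each augmentation joins a power below [y] but not below [u]. It raises the rank of [u] by one
    and that of its meet with [y] by at least one, so their gap never exceeds one. *)
Lemma augment_from I u y : matroid rho I -> u \in I -> y \in I -> rho u <= rho y ->
  rho u <= (rho (u `&` y)%O).+1 ->
  exists z, [/\ z \in I, (u <= z)%O, rho z = rho y & rho z <= (rho (z `&` y)%O).+1].
Proof.
move=> [_ _ I3] + Iy; move: {2}(rho y - rho u) (erefl (rho y - rho u)) => n.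
elim: n u => [|n IHn] u dn Iu le_uy le_uI.
  exists u; split=> //; apply/eqP; rewrite eqn_leq le_uy /=.
  by rewrite -subn_eq0 dn.
have lt_uy : rho u < rho y by rewrite -subn_gt0 dn.
have [a [p [aa lt_v ap Iup]]] := I3 u y Iu Iy lt_uy.
have rup := rho_join_next_power aa ap.
have le_py : (p <= y)%O by apply: power_le aa ap lt_v.
have [|||z [Iz le_uz rz rzI]] := IHn (u `|` p)%O _ Iup.
- by rewrite rup subnS dn.
- by rewrite rup.
- rewrite rup ltnS; apply: (leq_trans le_uI); apply: rho_lt.
  rewrite lt_neqAle leI2 ?leUl // andbT; apply: contraNneq (next_power_nle ap) => eqI.
  by apply: (@le_trans _ _ (u `&` y)%O); rewrite ?leIl // eqI lexI leUr.
by exists z; split=> //; apply: le_trans le_uz; apply: leUl.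
Qed.

Lemma exchange_step I a x y : matroid rho I -> a \in atoms rho ->
  x \in I -> y \in I -> rho x = rho y -> vmult rho a y < vmult rho a x ->
  exists z, [/\ z \in I, rho z = rho y, (x `&` y <= z)%O,
    vmult rho a y < vmult rho a z & (rho (z `&` y)%O).+1 = rho y].
Proof.
move=> matI aa Ix Iy rxy lt_v; have [_ I2 _] := matI.
have vI : vmult rho a (x `&` y)%O = vmult rho a y.
  by rewrite vmultI //; apply/minn_idPr/ltnW.
(* By [vI], this [p] is also the next power of [a] for the meet of [x] and [y]. *)
have [|p [ap le_px]] := @power_le_exists a x (vmult rho a y).+1 aa; first exact: lt_v.
have ru : rho ((x `&` y) `|` p)%O = (rho (x `&` y)%O).+1.
  by apply: (@rho_join_next_power a) => //; rewrite vI.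
have le_ux : ((x `&` y) `|` p <= x)%O by rewrite leUx leIl.
have [|||z [Iz le_uz rz rzI]] := @augment_from I ((x `&` y) `|` p)%O y matI _ Iy.
- exact: I2 le_ux Ix.
- by rewrite -rxy rho_le.
- by rewrite ru ltnS rho_le // lexI leUl leIr.
have lt_vz : vmult rho a y < vmult rho a z.
  have [pw <-] := ap; apply: rho_le_vmult => //.
  exact: le_trans (leUr _ _) le_uz.
exists z; split=> //; first exact: le_trans (leUl _ _) le_uz.
(* If the meet were [y], then [y] would lie below [z] with equal rank, so [z] would be [y], against
   [lt_vz]. *)
apply/eqP; rewrite eqn_leq -{2}rz rzI andbT; apply: rho_lt.
rewrite lt_neqAle leIr andbT; apply: contraTneq lt_vz => eqI.
rewrite -leqNgt; suff -> : z = y by [].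
have le_yz : (y <= z)%O by rewrite leEmeet meetC; apply/eqP.
by rewrite (le_rho_eq le_yz).
Qed.

(** * The order on elements of fixed rank *)

Section RankOrder.
Variable le1 : rel P.
Hypothesis le1P : total_order_on_atoms rho le1.

Let sorted_atoms := sort le1 (enum (atoms rho)).

Lemma mem_sorted_atoms w : (w \in sorted_atoms) = (w \in atoms rho).
Proof. by rewrite mem_sort mem_enum. Qed.

Lemma pairwise_sorted_atoms : pairwise [rel a b | le1 a b && ~~ le1 b a] sorted_atoms.
Proof.
have [_ le1_anti le1_trans le1_total] := le1P.
have all_at : all (mem (atoms rho)) sorted_atoms.
  by apply/allP => w; rewrite mem_sorted_atoms.
have : pairwise le1 sorted_atoms.
  rewrite -(sorted_pairwise_in le1_trans) //.
  by apply: (sort_sorted_in le1_total); apply/allP => w; rewrite mem_enum.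
have : pairwise [rel a b | a != b] sorted_atoms.
  by rewrite -uniq_pairwise sort_uniq enum_uniq.
move=> pw_ne pw_le; have := conj pw_ne pw_le => /andP; rewrite -pairwise_relI.
apply: (sub_in_pairwise _ all_at) => a b aa ab /= /andP[ne_ab le_ab].
rewrite le_ab /=; apply: contra ne_ab => le_ba.
by apply/eqP/le1_anti => //; rewrite le_ab.
Qed.

(** Atoms not below [x] have multiplicity zero, so one list of atoms serves all [x]. *)
Lemma factorization_expand x :
  factorization rho le1 x = expand (fun w => vmult rho w x) sorted_atoms.
Proof.
have [_ _ le1_trans le1_total] := le1P.
have -> : factorization rho le1 x =
    expand (fun w => vmult rho w x) [seq w <- sorted_atoms | (w <= x)%O].
  rewrite /factorization /sorted_atoms (filter_sort_in le1_total le1_trans); last first.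
    by apply/allP => w; rewrite mem_enum.
  congr (flatten (map _ (sort _ _))); rewrite -filter_predI.
  by apply: eq_filter => w; rewrite /= !inE andbC.
elim: (sorted_atoms) => [//|w s IHs]; rewrite [RHS]/expand /= -/(expand _ _) -IHs.
by case: ifP => // nle; rewrite [vmult rho w x]/vmult nle.
Qed.

(** Equal ranks give equal multiplicity sums, which the comparison of expansions requires. *)
Lemma rank_ltE l x y : rank_lt rho le1 l x y =
  [&& rho x == l, rho y == l
    & lex_gt (fun w => vmult rho w x) (fun w => vmult rho w y) sorted_atoms].
Proof.
rewrite /rank_lt; case: eqP => //= rx; case: eqP => //= ry.
rewrite !factorization_expand first_diff_lt_expand ?pairwise_sorted_atoms //.
  by case: eqVneq => [->|//]; rewrite lex_gt_irr.
have [_ _ _ sumP] := powP.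
have big_at F : \sum_(w <- sorted_atoms) F w = \sum_(w in atoms rho) F w.
  by rewrite (perm_big (enum (atoms rho))) ?big_enum // perm_sort.
by rewrite !big_at; apply/sumP; rewrite rx ry.
Qed.

Lemma rank_lt_irr l x : rank_lt rho le1 l x x = false.
Proof. by rewrite /rank_lt eqxx !andbF. Qed.

Lemma rank_lt_trans l : transitive (rank_lt rho le1 l).
Proof.
move=> y x z; rewrite !rank_ltE => /and3P[-> _ xy] /and3P[_ -> yz] /=.
exact: lex_gt_trans xy yz.
Qed.

Lemma rank_le_trans l : transitive (rank_le rho le1 l).
Proof.
move=> y x z /orP[/andP[_ /eqP->]//|xy] /orP[/andP[_ /eqP<-]|yz].
  by rewrite /rank_le xy orbT.
by rewrite /rank_le (rank_lt_trans xy yz) orbT.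
Qed.

Lemma rank_le_total l : {in [pred x | rho x == l] &, total (rank_le rho le1 l)}.
Proof.
move=> x y rx ry; rewrite !inE in rx ry.
apply: contraT; rewrite /rank_le !rank_ltE rx ry /= !negb_or.
case/and3P=> /andP[ne_xy nxy] _ nyx; case/eqP: ne_xy; apply: vmult_inj => w aw.
by apply: (lex_gt_total nxy nyx); rewrite mem_sorted_atoms.
Qed.

Lemma pairwise_rank_lt_sort l s : uniq s -> all [pred x | rho x == l] s ->
  pairwise (rank_lt rho le1 l) (sort (rank_le rho le1 l) s).
Proof.
move=> us rs; set t := sort _ s.
have st : sorted (rank_le rho le1 l) t := sort_sorted_in (@rank_le_total l) rs.
have pw_le : pairwise (rank_le rho le1 l) t by rewrite -sorted_pairwise //; apply: rank_le_trans.
have pw_ne : pairwise [rel a b | a != b] t by rewrite -uniq_pairwise sort_uniq.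
have := conj pw_ne pw_le => /andP; rewrite -pairwise_relI.
by apply: sub_pairwise => a b /= /andP[/negPf ne_ab]; rewrite /rank_le ne_ab andbF.
Qed.

Lemma earlier_exchange I l x y : matroid rho I -> x \in I -> y \in I ->
  rank_lt rho le1 l x y ->
  exists z, [/\ z \in I, rank_lt rho le1 l z y, (x `&` y <= z)%O
    & (rho (z `&` y)%O).+1 = l].
Proof.
move=> matI Ix Iy; rewrite rank_ltE => /and3P[/eqP rx /eqP ry].
case/lex_gtP=> s1 [a [s2 [def_s eq_v lt_a]]].
have s_at w : w \in s1 ++ a :: s2 -> w \in atoms rho by rewrite -def_s mem_sorted_atoms.
have aa : a \in atoms rho by apply: s_at; rewrite mem_cat mem_head orbT.
have [z [Iz rz le_z lt_z rzI]] := exchange_step matI aa Ix Iy (etrans rx (esym ry)) lt_a.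
exists z; split=> //; last by rewrite rzI.
rewrite rank_ltE rz ry eqxx def_s /=; apply: lex_gt_cat => // w ws.
have aw : w \in atoms rho by apply: s_at; rewrite mem_cat ws.
apply: leq_trans (vmult_le aw le_z).
by rewrite vmultI //= (eq_v w ws) minnn.
Qed.

End RankOrder.

(** Otherwise an element of [I] of largest rank strictly above [z] would be a basis of rank greater
    than [r]. *)
Lemma basis_of_rank I r z : (forall b, b \in bases I -> rho b = r) ->
  z \in I -> rho z = r -> z \in bases I.
Proof.
move=> rB Iz rz; rewrite inE Iz /=; apply/existsP => -[y0 /andP[Iy0 lt_zy0]].
have Py0 : (y0 \in I) && (z < y0)%O by rewrite Iy0.
case: (@arg_maxnP _ y0 (fun y => (y \in I) && (z < y)%O) rho Py0) => y /andP[Iy lt_zy] max_y.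
have By : y \in bases I.
  rewrite inE Iy; apply/existsP => -[t /andP[It lt_yt]].
  have le_ty : rho t <= rho y by apply: max_y; rewrite It (lt_trans lt_zy).
  by have := rho_lt lt_yt; rewrite ltnNge le_ty.
by have := rho_lt lt_zy; rewrite rz (rB y By) ltnn.
Qed.

End PowerLatticeTheory.

(** * Shelling by the sorted list of bases *)

Theorem theorem44 (disp : Order.disp_t) (P : finTBLatticeType disp)
    (rho : P -> nat) (le1 : rel P) (I : {set P}) (r : nat) :
  power_lattice rho ->
  total_order_on_atoms rho le1 ->
  matroid rho I ->
  (forall b : P, b \in bases I -> rho b = r) ->
  let fs := sort (rank_le rho le1 r) (enum (bases I)) in
  pairwise (rank_lt rho le1 r) fs /\ shellable_wrt rho I r fs.
Proof.
move=> powP le1P matI rB fs.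
have mem_fs x : (x \in fs) = (x \in bases I) by rewrite mem_sort mem_enum.
have pw : pairwise (rank_lt rho le1 r) fs.
  apply: pairwise_rank_lt_sort => //; first exact: enum_uniq.
  by apply/allP => x; rewrite mem_enum => /rB /eqP.
have [I1 I2 _] := matI.
split=> //; split.
- by split=> //; apply/set0Pn; exists \bot%O.
- exact: rB.
- by split=> //; rewrite sort_uniq enum_uniq.
move=> i j /andP[lt_ij lt_j]; have lt_i := ltn_trans lt_ij lt_j.
have nthI k : k < size fs -> nth \bot%O fs k \in I.
  by move=> lt_k; have := mem_nth \bot%O lt_k; rewrite mem_fs inE => /andP[].
have nth_lt := elimT (pairwiseP \bot%O) pw.
have [z [Iz lt_zj le_z rz]] :=
  earlier_exchange powP le1P matI (nthI _ lt_i) (nthI _ lt_j) (nth_lt _ _ lt_i lt_j lt_ij).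
have fs_z : z \in fs.
  rewrite mem_fs; apply: (basis_of_rank powP rB Iz).
  by case/and4P: lt_zj => /eqP.
(* The position of [z] precedes [j]: otherwise sortedness would make [z] equal to, or later than,
   the facet at [j], against [lt_zj]. *)
exists (index z fs); rewrite nth_index //; split=> //; last by rewrite lexI le_z leIr.
rewrite ltnNge leq_eqVlt; apply/negP => /predU1P[def_j|lt_jz].
  by move: lt_zj; rewrite def_j nth_index // rank_lt_irr.
have := nth_lt j (index z fs) lt_j; rewrite inE index_mem nth_index // => /(_ fs_z lt_jz) lt_yz.
by have := rank_lt_trans powP le1P lt_yz lt_zj; rewrite rank_lt_irr.
Qed.
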